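(* Let $G$ be a finite acyclic directed graph. Then the independence poset $\mathrm{top}(G)$ is a lattice if and only if $G$ has no partition of its vertices $G=X_1\sqcup X_2\sqcup X_3\sqcup X_4\sqcup Z$ such that (i) all the $X_i$ are non-empty (but $Z$ may be empty); (ii) every element of $X_3$ has an edge from some element of $X_4$ and an edge to some element of $X_2$; (iii) every element of $X_2$ has an edge to some element of $X_1$ and an edge from some element of $X_3$; (iv) there are no edges from $X_4$ to $X_2$, from $X_4$ to $X_1$, or from $X_3$ to $X_1$; (v) every element of $Z$ has an edge from some element of $X_4$ and an edge to some element of $X_1$.
   Context: All directed graphs are finite, acyclic (no directed cycles, hence no loops) and without multiple edges; $g\in G$ means $g$ is a vertex of $G$, and $g\to h$ denotes an edge from $g$ to $h$. The $G$-order is the partial order on vertices with $g_1\ge g_2$ iff there is a directed path (possibly of length $0$) from $g_1$ to $g_2$. An independent set is a set of pairwise non-adjacent vertices. A pair $(\mathcal D,\mathcal U)$ of disjoint independent sets is orthogonal if there is no edge from an element of $\mathcal D$ to an element of $\mathcal U$. An orthogonal pair of independent sets is tight if none of the following operations results in an orthogonal pair of independent sets: removing some $d\in\mathcal D$ and inserting in $\mathcal D$ an element $d'\notin\mathcal D$ with $d'>d$; removing some $u\in\mathcal U$ and inserting in $\mathcal U$ an element $u'\notin\mathcal U$ with $u'<u$; adding a new element to $\mathcal D$; adding a new element to $\mathcal U$. A tight orthogonal pair is called a top, and $\mathrm{top}(G)$ is the set of tops of $G$. A linear extension $\ell$ of $G$-order is a total order on the vertices such that if $g_1\to g_2$ is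 an edge then $g_2$ precedes $g_1$; a reverse linear extension $\ell'$ is a total order in which $g_1$ precedes $g_2$ whenever $g_1\to g_2$. Flips: for $(\mathcal D,\mathcal U)\in\mathrm{top}(G)$ and $g\in G$, define $\mathrm{flip}_g(\mathcal D,\mathcal U)=(\mathcal D,\mathcal U)$ if $g\notin\mathcal D\cup\mathcal U$. Otherwise start with $\mathcal D'=\{k\in\mathcal D: k\not\le g\}$ and $\mathcal U'=\{k\in\mathcal U:k\not\ge g\}$; add $g$ to $\mathcal D'$ if $g\in\mathcal U$, and add $g$ to $\mathcal U'$ if $g\in\mathcal D$. Then, for $k\not\ge g$ in the order of a reverse linear extension $\ell'$, add $k$ to $\mathcal D'$ if $k\notin\mathcal U'$, there is no edge from $k$ to $\mathcal U'$, and there is no edge from the current $\mathcal D'$ to $k$. Then, for $k\not\le g$ in the order of a linear extension $\ell$, add $k$ to $\mathcal U'$ if $k\notin\mathcal D'$, there is no edge from $\mathcal D'$ to $k$, and there is no edge from $k$ to the current $\mathcal U'$. The result $(\mathcal D',\mathcal U')$ is $\mathrm{flip}_g(\mathcal D,\mathcal U)$; it is a top and does not depend on the choice of $\ell,\ell'$. The independence poset, also denoted $\mathrm{top}(G)$, is the set $\mathrm{top}(G)$ with the reflexive and transitive closure of the relations $(\mathcal D,\mathcal U)<\mathrm{flip}_g(\mathcal D,\mathcal U)$ for $g\in\mathcal U$ (this is a partial order).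
   Formalization: In ''tight'', one inserted d' may replace any nonempty set of smaller elements of D (dually for U), not just a single d; with a single d the claim fails for the graph 0→2, 1→2, 2→3, 2→4, where ({2},{0,1}) and ({3,4},{0,1}) have no join. *)

(* Defs.v *)
From mathcomp Require Import all_boot.

Set Implicit Arguments.
Unset Strict Implicit.
Unset Printing Implicit Defensive.

(* A finite directed graph without multiple edges is a relation [e] on a      *)
(* [finType]; [e g h] is the edge g -> h.                                     *)
Section IndependencePosets.

Variables (T : finType) (e : rel T).

Implicit Types (g h k : T) (A B D U : {set T}) (p : {set T} * {set T}).

(* The length-one cycle [:: g] is a loop at g. *)
Definition acyclic : Prop := forall c : seq T, c != [::] -> ~~ cycle e c.

Definition Gge : rel T := connect e.
Definition Ggt : rel T := fun g h => (g != h) && Gge g h.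

Definition independent A : bool :=
  [forall g in A, forall h in A, ~~ e g h].

Definition orthogonal p : bool :=
  [&& independent p.1, independent p.2, [disjoint p.1 & p.2] &
      [forall d in p.1, forall u in p.2, ~~ e d u]].

(* A vertex d' may replace any nonempty set A of smaller elements of D, and   *)
(* dually for U. Allowing only #|A| = 1 would be too weak: in the graph with  *)
(* edges 0 -> 2, 1 -> 2, 2 -> 3, 2 -> 4, both ({2}, {0, 1}) and               *)
(* ({3, 4}, {0, 1}) would then be tight, so U would not determine the top;    *)
(* they would have the two minimal upper bounds ({0, 3, 4}, {1}) and          *)
(* ({1, 3, 4}, {0}), although the graph has no forbidden partition.           *)
Definition tight p : bool :=
  let: (D, U) := p in
  [&& [forall (d' | d' \notin D), forall (A : {set T} |
         [&& A != set0, A \subset D & [forall d in A, Ggt d' d]]),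
         ~~ orthogonal (d' |: (D :\: A), U)],
      [forall (u' | u' \notin U), forall (A : {set T} |
         [&& A != set0, A \subset U & [forall u in A, Ggt u u']]),
         ~~ orthogonal (D, u' |: (U :\: A))],
      [forall (d' | d' \notin D), ~~ orthogonal (d' |: D, U)] &
      [forall (u' | u' \notin U), ~~ orthogonal (D, u' |: U)]].

Definition is_top p : bool := orthogonal p && tight p.

Definition top : Type := {p : {set T} * {set T} | is_top p}.

(* A total order on the vertices is given by listing them, least first. *)
Definition linear_extension (l : seq T) : Prop :=
  perm_eq l (enum T) /\ forall g h, e g h -> index h l < index g l.

Definition reverse_linear_extension (l : seq T) : Prop :=
  perm_eq l (enum T) /\ forall g h, e g h -> index g l < index h l.

Section Flip.

(* The flip does not depend on the choice of the linear extension l and of    *)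
(* the reverse linear extension l'.                                           *)
Variables l l' : seq T.

Definition add_down g U D k : {set T} :=
  if [&& ~~ Gge k g, k \notin U, [forall u in U, ~~ e k u] &
         [forall d in D, ~~ e d k]]
  then k |: D else D.

Definition add_up g D U k : {set T} :=
  if [&& ~~ Gge g k, k \notin D, [forall d in D, ~~ e d k] &
         [forall u in U, ~~ e k u]]
  then k |: U else U.

Definition flip g p : {set T} * {set T} :=
  let: (D, U) := p in
  if g \notin D :|: U then (D, U) else
  let D0 := [set k in D | ~~ Gge g k] in
  let U0 := [set k in U | ~~ Gge k g] in
  let D1 := if g \in U then g |: D0 else D0 in
  let U1 := if g \in D then g |: U0 else U0 in
  let D2 := foldl (add_down g U1) D1 l' in
  let U2 := foldl (add_up g D2) U1 l in
  (D2, U2).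

Definition flip_up : rel top :=
  fun x y => [exists g in (val x).2, val y == flip g (val x)].

Definition top_le : rel top := connect flip_up.

End Flip.

Definition no_edge A B : Prop := forall g h, g \in A -> h \in B -> ~~ e g h.

(* The library's [partition] would force Z to be nonempty and would identify  *)
(* equal blocks.                                                              *)
Definition forbidden_partition (X1 X2 X3 X4 Z : {set T}) : Prop :=
  let blocks := [:: X1; X2; X3; X4; Z] in
  [/\ pairwise (fun A B => [disjoint A & B]) blocks &
      \bigcup_(A <- blocks) A = [set: T]] /\
  [/\ [/\ X1 != set0, X2 != set0, X3 != set0 & X4 != set0],
      forall x, x \in X3 ->
        (exists2 y, y \in X4 & e y x) /\ (exists2 y, y \in X2 & e x y),
      forall x, x \in X2 ->
        (exists2 y, y \in X1 & e x y) /\ (exists2 y, y \in X3 & e y x),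
      [/\ no_edge X4 X2, no_edge X4 X1 & no_edge X3 X1] &
      forall x, x \in Z ->
        (exists2 y, y \in X4 & e y x) /\ (exists2 y, y \in X1 & e x y)].

End IndependencePosets.

Arguments flip_up {T} e l l' x y.
Arguments top_le {T} e l l' x y.

Section Lattices.

Variables (P : Type) (le : P -> P -> bool).

Definition is_meet (x y m : P) : Prop :=
  [/\ le m x, le m y & forall z, le z x -> le z y -> le z m].

Definition is_join (x y j : P) : Prop :=
  [/\ le x j, le y j & forall z, le x z -> le y z -> le j z].

Definition is_lattice : Prop :=
  [/\ reflexive le, antisymmetric le, transitive le,
      forall x y, exists m, is_meet x y m &
      forall x y, exists j, is_join x y j].

End Lattices.

(* Main.v *)
Require Import Defs.
From mathcomp Require Import all_boot.

Set Implicit Arguments.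
Unset Strict Implicit.
Unset Printing Implicit Defensive.

(** A pair (D, U) is a top exactly when D and U are disjoint and D :|: U
    consists of all the vertices that receive no edge from D and send no edge
    to U ([saturated]). A flip at g is then the passage between two such pairs
    where g moves from U to D, D is unchanged except at or below g, and U is
    unchanged except at or above g ([step]). Both notions are self-dual under
    reversing the edges and exchanging D and U, so a fact about D yields one
    about U.

    The other ingredient is the Galois connection of the relation: g = h or
    g -> h. Write perp Y for the set of vertices not related to any element of
    Y, and perp' for the same on the reversed graph. The closed sets perp Y
    form a lattice under inclusion. A forbidden partition is the same thing as
    a pair of closed sets X < X' such that X' is disjoint from perp' X: take
    X4 = X, X3 = X' \ X, X1 = perp' X' and X2 = perp' X \ perp' X'. If no such
    pair exists the graph is called [overlapping] here.

    If the graph is overlapping, (D, U) |-> perp U is a bijection from the tops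
    to the closed sets; flips go up for inclusion ([step_perp]) and every
    minimal strict inclusion of closed sets is a flip ([minimal_step]). Hence
    the independence poset is the lattice of closed sets.

    Conversely suppose that the independence poset is a lattice. Let j_g be the
    top with D = {g} and m_h the top with U = {h}. In any graph, j_g <= (D, U)
    as soon as g is in perp U ([steps_generator]), and dually; so the relation
    j_g <= m_h can fail only if g = h or g -> h. Existence of joins makes it
    fail for g = h ([generator_not_below]). Let r g h hold if g and h are
    distinct and j_g <= m_h fails: it is a subgraph of G. Existence of meets
    makes every closed set of r of the form {g | j_g <= t} for some top t. On
    the other hand a graph has at least as many closed sets as tops, and as
    many tops as independent sets. Therefore

      #tops G >= #closed r >= #tops r = #independent r >= #independent G,

    where the last term is #tops G again. So r = G, and G has as many closed
    sets as tops ([lattice_card]). Then (D, U) |-> perp U and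
    (D, U) |-> perp (perp' D) are two bijections onto the closed sets, the
    second one below the first, so they coincide. A forbidden partition would
    yield a top whose images under the two are X4 :|: X3 and X4. *)

(** * Saturated pairs, steps and the polarity of a graph *)

Section Basics.
Variable T : finType.
Implicit Types (e : rel T) (A B X Y : {set T}) (p q : {set T} * {set T}).

Definition converse e : rel T := fun g h => e h g.
Definition swap p := (p.2, p.1).

Definition no_out e A k := [forall u in A, ~~ e k u].

(** The first-order form of tightness, visibly self-dual. *)
Definition saturated e p :=
  [disjoint p.1 & p.2] &&
  [forall k, (k \in p.1 :|: p.2) ==
             no_out (converse e) p.1 k && no_out e p.2 k].

(** The polarity of the reflexive closure of [e]; its other half is
    [perp (converse e)]. *)
Definition perp e Y := [set g | (g \notin Y) && no_out e Y g].

(** A flip, described by what it preserves instead of by an algorithm. *)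
Definition step e g p q : bool :=
  [&& saturated e p, saturated e q, g \in p.2, g \in q.1,
      [forall k, ~~ Gge e g k ==> ((k \in p.1) == (k \in q.1))] &
      [forall k, ~~ Gge e k g ==> ((k \in p.2) == (k \in q.2))]].

Definition steps e : rel ({set T} * {set T}) :=
  connect (fun p q => [exists g, step e g p q]).

(** The common shape of the two completion loops of a flip. *)
Definition greedy e (C : pred T) (A : {set T}) (s : seq T) :=
  foldl (fun B k => if C k && no_out e B k then k |: B else B) A s.

Lemma no_outP e A k : reflect (forall u, u \in A -> ~~ e k u) (no_out e A k).
Proof. exact: (iffP forall_inP). Qed.

Lemma no_outS e A B k : A \subset B -> no_out e B k -> no_out e A k.
Proof. by move=> /subsetP AB /no_outP kB; apply/no_outP => u /AB/kB. Qed.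

Lemma eq_no_out e A B k :
  (forall u, e k u -> (u \in A) = (u \in B)) -> no_out e A k = no_out e B k.
Proof.
move=> AB; apply/no_outP/no_outP => H u uX; apply/negP => ku.
  by move: (H u); rewrite AB // uX ku => /(_ isT).
by move: (H u); rewrite -AB // uX ku => /(_ isT).
Qed.

Lemma saturatedP e p :
  reflect ((forall k, k \in p.1 -> k \notin p.2) /\
           (forall k, (k \in p.1 :|: p.2) =
                      no_out (converse e) p.1 k && no_out e p.2 k))
          (saturated e p).
Proof.
apply: (iffP andP) => -[H1 H2]; split.
- by move=> k kD; rewrite (disjointFr H1 kD).
- by move=> k; apply/eqP/(forallP H2).
- by rewrite disjoint_subset; apply/subsetP => k /H1.
- by apply/forallP => k; rewrite H2.
Qed.

Lemma swapK : involutive swap.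
Proof. by case. Qed.

Lemma Gge_converse e g h : Gge (converse e) g h = Gge e h g.
Proof. exact: (connect_rev e g h). Qed.

Lemma saturated_converse e p : saturated (converse e) (swap p) = saturated e p.
Proof.
rewrite /saturated /= disjoint_sym; congr (_ && _).
by apply: eq_forallb => k; rewrite setUC andbC.
Qed.

Lemma step_converse e g p q :
  step (converse e) g (swap q) (swap p) = step e g p q.
Proof.
rewrite /step !saturated_converse /=.
rewrite andbCA; do 2 congr (_ && _); rewrite andbCA; do 2 congr (_ && _).
by rewrite andbC; congr (_ && _); apply: eq_forallb => k;
  rewrite Gge_converse eq_sym.
Qed.

Lemma steps_converse e p q :
  steps (converse e) (swap q) (swap p) = steps e p q.
Proof.
have sub e1 p1 q1 : steps e1 p1 q1 -> steps (converse e1) (swap q1) (swap p1).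
  case/connectP => s; elim: s p1 => [|r s IHs] p1 /=.
    by move=> _ ->; apply: connect0.
  case/andP=> /existsP [g Hg] rs q1E; apply: connect_trans (IHs r rs q1E) _.
  by apply: connect1; apply/existsP; exists g; rewrite step_converse.
apply/idP/idP; last exact: sub.
by move/sub; rewrite !swapK.
Qed.

Lemma stepP e g p q : step e g p q ->
  [/\ saturated e p, saturated e q, g \in p.2, g \in q.1 &
      (forall k, ~~ Gge e g k -> (k \in p.1) = (k \in q.1)) /\
      (forall k, ~~ Gge e k g -> (k \in p.2) = (k \in q.2))].
Proof.
case/and5P => ? ? ? ? /andP [/forallP H1 /forallP H2]; split=> //; split=> k Hk.
  by apply/eqP/(implyP (H1 k)).
by apply/eqP/(implyP (H2 k)).
Qed.

Lemma step_steps e g p q : step e g p q -> steps e p q.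
Proof. by move=> s; apply: connect1; apply/existsP; exists g. Qed.

Lemma perpP e Y g :
  reflect (forall h, h \in Y -> (g != h) && ~~ e g h) (g \in perp e Y).
Proof.
rewrite inE; apply: (iffP andP).
  move=> [gY /no_outP gH] h hY; rewrite gH // andbT.
  by apply: contraNneq gY => ->.
move=> H; split; last by apply/no_outP => u /H /andP [].
by apply/negP => /H; rewrite eqxx.
Qed.

Lemma notin_perpP e Y g :
  g \notin perp e Y -> exists2 h, h \in Y & (g == h) || e g h.
Proof.
move=> gY; apply/exists_inP; apply: contraNT gY => /exists_inPn H.
by apply/perpP => h /H; rewrite negb_or.
Qed.

Lemma perpS e Y Y' : Y \subset Y' -> perp e Y' \subset perp e Y.
Proof.
move=> /subsetP YY; apply/subsetP => g /perpP H.
by apply/perpP => h /YY/H.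
Qed.

Lemma perp_galois e X Y :
  (X \subset perp e Y) = (Y \subset perp (converse e) X).
Proof.
apply/subsetP/subsetP => H h hY; apply/perpP => g gX.
  by rewrite eq_sym; move/perpP: (H g gX); apply.
by rewrite eq_sym; move/perpP: (H g gX); apply.
Qed.

Lemma perp_sub e Y : Y \subset perp (converse e) (perp e Y).
Proof. by rewrite -perp_galois. Qed.

Lemma perpK e Y : perp e (perp (converse e) (perp e Y)) = perp e Y.
Proof.
apply/eqP; by rewrite eqEsubset perpS ?perp_sub.
Qed.

Lemma perpU e A B : perp e (A :|: B) = perp e A :&: perp e B.
Proof.
apply/setP => g; rewrite in_setI.
apply/perpP/andP => [H | [/perpP HA /perpP HB] h].
  by split; apply/perpP => h hA; apply: H; rewrite inE hA ?orbT.
by rewrite inE => /orP [/HA|/HB].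
Qed.

(** D is the kernel of the reversed graph on perp U, hence is determined by
    perp U. *)
Lemma saturated_mem1 e p k : saturated e p ->
  (k \in p.1) = (k \in perp e p.2) && no_out (converse e) p.1 k.
Proof.
case/saturatedP => dis fr; rewrite inE -andbA [X in _ && X]andbC -fr inE.
case kD: (k \in p.1); first by rewrite dis.
by case: (k \in p.2).
Qed.

Lemma saturated_mem2 e p k : saturated e p ->
  (k \in p.2) = (k \in perp (converse e) p.1) && no_out e p.2 k.
Proof.
by rewrite -saturated_converse => /(saturated_mem1 k).
Qed.

Lemma saturated_sub1 e p : saturated e p -> p.1 \subset perp e p.2.
Proof.
by move=> sp; apply/subsetP => k; rewrite (saturated_mem1 _ sp) => /andP [].
Qed.

Lemma saturated_sub2 e p : saturated e p -> p.2 \subset perp (converse e) p.1.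
Proof. by move=> sp; rewrite -perp_galois saturated_sub1. Qed.

(** The two polar sets attached to a saturated pair do not meet: a common
    element would be unblocked without lying in D or U. *)
Lemma perp_both e p k : saturated e p -> k \in perp e p.2 ->
  k \notin perp (converse e) p.1.
Proof.
case/saturatedP => _ free; rewrite !inE => /andP [kU ko].
apply/negP => /andP [kD ki]; move: (free k).
by rewrite ki ko inE (negPf kD) (negPf kU).
Qed.

Lemma independent_saturated e p : saturated e p -> independent e p.1.
Proof.
move=> /saturated_mem1 H; apply/forall_inP => g gD; apply/forall_inP => h.
by rewrite H => /andP [_ /no_outP]; apply.
Qed.

End Basics.

(** * Kernels *)

Section Kernels.
Variables (T : finType) (e : rel T) (l : seq T).
Hypothesis hl : linear_extension e l.
Implicit Types (A B D X : {set T}) (p q : {set T} * {set T}).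

Lemma index_lt g h : e g h -> index h l < index g l.
Proof. exact: hl.2. Qed.

Lemma ext_mem k : k \in l.
Proof. by rewrite (perm_mem hl.1) mem_enum. Qed.

Lemma Gge_index g h : Gge e g h -> index h l <= index g l.
Proof.
case/connectP => s; elim: s g => [|k s IHs] g /=; first by move=> _ ->.
by case/andP => /index_lt kg ks /(IHs _ ks) hk; apply: leq_trans hk (ltnW kg).
Qed.

Lemma Gge_anti g h : Gge e g h -> Gge e h g -> g = h.
Proof.
move=> /Gge_index hg /Gge_index gh.
have /eqP eq_i : index g l == index h l by rewrite eqn_leq gh hg.
by rewrite -(nth_index g (ext_mem g)) eq_i nth_index ?ext_mem.
Qed.

Lemma edge_irr g : e g g = false.
Proof. by apply/negP => /index_lt; rewrite ltnn. Qed.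

Lemma edge_not_Gge g h : e g h -> ~~ Gge e h g.
Proof.
by move=> gh; apply/negP => /Gge_index; rewrite leqNgt index_lt.
Qed.

Lemma sink_ind (P : T -> Prop) :
  (forall k, (forall h, e k h -> P h) -> P k) -> forall k, P k.
Proof.
move=> IH k; have [n] := ubnP (index k l).
elim: n k => // n IHn k kn; apply: IH => h /index_lt hk.
by apply: IHn; apply: leq_trans hk _.
Qed.

Lemma set_sink_ind A B :
  (forall k, (forall h, e k h -> (h \in A) = (h \in B)) ->
             (k \in A) = (k \in B)) ->
  A = B.
Proof. by move=> H; apply/setP => k; elim/sink_ind: k. Qed.

(** When k is reached, every vertex it has an edge to has already been
    processed, so testing the current set is testing the final one. *)
Lemma greedyP (C : pred T) A k :
  (k \in greedy e C A l) = (k \in A) || C k && no_out e (greedy e C A l) k.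
Proof.
pose f B k := if C k && no_out e B k then k |: B else B.
have grow s B : B \subset foldl f B s.
  elim: s B => //= x s IHs B; apply: subset_trans (IHs _).
  by rewrite /f; case: ifP => // _; apply: subsetUr.
have new s B x : x \in foldl f B s -> (x \in B) || (x \in s).
  elim: s B => [|y s IHs] B /=; first by move=> ->.
  move/IHs; rewrite inE /f; case: ifP => _; last first.
    by case: (x \in B) => //= ->; rewrite orbT.
  by rewrite !inE; case: (x == y); case: (x \in B).
have ul : uniq l by rewrite (perm_uniq hl.1) enum_uniq.
rewrite /greedy -/f; move: (ext_mem k) => kl; move: ul.
have idx := index_lt; case/splitPr: l / kl idx => s1 s2 idx.
rewrite cat_uniq /= negb_or -andbA => /and5P [us1 ks1 Hs12 ks2 us2].
rewrite foldl_cat /=.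
set A1 := foldl f A s1; set F := foldl f (f A1 k) s2.
have kA1 : (k \in A1) = (k \in A).
  apply/idP/idP; last exact: (subsetP (grow _ _)).
  by case/new/orP => //; rewrite (negPf ks1).
have -> : (k \in F) = (k \in f A1 k).
  apply/idP/idP; last exact: (subsetP (grow _ _)).
  by case/new/orP => //; rewrite (negPf ks2).
have -> : no_out e F k = no_out e A1 k.
  apply/idP/idP.
    apply: no_outS; apply: subset_trans (grow s2 _).
    by rewrite /f; case: ifP => // _; apply: subsetUr.
  move/no_outP => H; apply/no_outP => u /new /orP [|us2'].
    rewrite /f; case: ifP => _; last exact: H.
    rewrite !inE => /predU1P [-> | /H //].
    by apply/negP => /idx; rewrite ltnn.
  apply/negP => /idx; rewrite !index_cat /= eqxx (negPf ks1).
  have /negPf -> : u \notin s1.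
    by apply: contra Hs12 => us1'; apply/hasP; exists u.
  by rewrite addn0 ltnNge leq_addr.
rewrite /f; case: ifP => _; rewrite ?kA1 ?orbF // !inE eqxx ?orbT ?kA1 //.
Qed.

Definition kernel X := greedy e (mem X) set0 l.

Lemma kernelP X k : (k \in kernel X) = (k \in X) && no_out e (kernel X) k.
Proof. by rewrite {1}/kernel greedyP inE. Qed.

Lemma kernel_sub X : kernel X \subset X.
Proof. by apply/subsetP => k; rewrite kernelP => /andP []. Qed.

Lemma kernel_unique X A B :
  (forall k, (k \in A) = (k \in X) && no_out e A k) ->
  (forall k, (k \in B) = (k \in X) && no_out e B k) -> A = B.
Proof.
move=> HA HB; apply: set_sink_ind => k /eq_no_out AB.
by rewrite HA HB AB.
Qed.

(** U is recovered from D as a kernel. *)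
Lemma saturated_inj1 p q :
  saturated e p -> saturated e q -> p.1 = q.1 -> p = q.
Proof.
case: p q => [D U] [D' U'] sp sq /= eqD; congr (_, _) => //.
apply: (@kernel_unique (perp (converse e) D)) => k.
  exact: (saturated_mem2 _ sp).
by rewrite eqD; apply: (saturated_mem2 _ sq).
Qed.

Definition complete D := (D, kernel (perp (converse e) D)).

Lemma saturated_complete D : independent e D -> saturated e (complete D).
Proof.
move=> /forall_inP ind; apply/saturatedP; split=> [k kD|k] /=.
  by rewrite kernelP inE kD.
rewrite inE kernelP inE; case: (boolP (k \in D)) => //= kD; symmetry.
apply/andP; split; apply/no_outP => u.
  by move=> /ind/forall_inP/(_ k kD).
by rewrite kernelP => /andP [/perpP /(_ k kD) /andP []].
Qed.

End Kernels.

(** * Flips are steps, tops are saturated pairs *)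

Section Flips.
Variables (T : finType) (e : rel T) (l l' : seq T).
Hypotheses (hl : linear_extension e l) (hl' : linear_extension (converse e) l').
Implicit Types (A X : {set T}) (p q : {set T} * {set T}).

Lemma kernel_independent X : independent e (kernel (converse e) l' X).
Proof.
apply/forall_inP => g gK; apply/forall_inP => h.
by rewrite (kernelP hl') => /andP [_ /no_outP]; apply.
Qed.

Lemma saturated_inj2 p q :
  saturated e p -> saturated e q -> p.2 = q.2 -> p = q.
Proof.
rewrite -!(saturated_converse e) => sp sq eqU; apply: (can_inj (@swapK T)).
exact: (saturated_inj1 hl').
Qed.

(** Below g the set U is known, so D is determined there from the sources
    down; D then determines U. *)
Lemma step_unique g p q q' : step e g p q -> step e g p q' -> q = q'.
Proof.
case/stepP => sp sq gU gq [H1 H2]; case/stepP => _ sq' _ gq' [H1' H2'].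
apply: (saturated_inj1 hl) => //; apply: (set_sink_ind hl') => k IH.
case gk: (Gge e g k); last by rewrite -H1 ?H1' ?gk.
case: (eqVneq k g) => [->|kg]; first by rewrite gq gq'.
have kg' : ~~ Gge e k g.
  by apply: contra kg => kg; apply/eqP; apply: (Gge_anti hl).
rewrite (saturated_mem1 _ sq) (saturated_mem1 _ sq') (eq_no_out IH) !inE.
rewrite -H2 // -H2' // (@eq_no_out _ e q.2 q'.2) // => u ku.
rewrite -H2 -?H2' //; apply: contra kg' => ug.
  exact: connect_trans (connect1 ku) ug.
exact: connect_trans (connect1 ku) ug.
Qed.

(** The first loop adds to D only vertices below g: the other candidates are
    blocked in (D, U), and the edges blocking them survive. Likewise the second
    loop adds to U only vertices above g. *)
Lemma flip_step g p :
  saturated e p -> g \in p.2 -> step e g p (flip e l l' g p).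
Proof.
case: p => D U /= sp gU; have [/= dis free] := elimT (saturatedP e (D, U)) sp.
have gD : g \notin D by apply: contraL gU; apply: dis.
have memD k : k \in D -> no_out (converse e) D k && no_out e U k.
  by move=> kD; rewrite -free inE kD.
have memU k : k \in U -> no_out (converse e) D k && no_out e U k.
  by move=> kU; rewrite -free inE kU orbT.
rewrite /flip in_setU gU orbT /= (negPf gD).
set D0 := [set k in D | _]; set U1 := [set k in U | _].
set D2 := foldl _ _ l'; set U2 := foldl _ _ l.
have D2E k : (k \in D2) = (k \in g |: D0) ||
    [&& ~~ Gge e k g, k \notin U1, no_out e U1 k & no_out (converse e) D2 k].
  pose C := [pred k | [&& ~~ Gge e k g, k \notin U1 & no_out e U1 k]].
  have -> : D2 = greedy (converse e) C (g |: D0) l'.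
    rewrite /D2 /greedy; elim: (l') (g |: D0) => //= x s IHs B; rewrite IHs.
    by rewrite /add_down /= -!andbA.
  by rewrite (greedyP hl') /= -!andbA.
have U2E k : (k \in U2) = (k \in U1) ||
    [&& ~~ Gge e g k, k \notin D2, no_out (converse e) D2 k & no_out e U2 k].
  pose C :=
    [pred k | [&& ~~ Gge e g k, k \notin D2 & no_out (converse e) D2 k]].
  have -> : U2 = greedy e C U1 l.
    rewrite /U2 /greedy; elim: (l) (U1) => //= x s IHs B; rewrite IHs.
    by rewrite /add_up /= -!andbA.
  by rewrite (greedyP hl) /= -!andbA.
have down d k : e d k -> ~~ Gge e g k -> ~~ Gge e g d.
  by move=> dk; apply: contra => gd; apply: connect_trans gd (connect1 dk).
have up k u : e k u -> ~~ Gge e k g -> ~~ Gge e u g.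
  by move=> dk; apply: contra; apply: connect_trans (connect1 dk).
have gg : Gge e g g by apply: connect0.
have U1U k : k \in U1 -> (k \in U) && ~~ Gge e k g by rewrite inE.
have sub1 k : k \in U1 -> k \in U2 by rewrite U2E => ->.
have agreeD k : ~~ Gge e g k -> (k \in D) = (k \in D2).
  move=> gk; have kg : k != g by apply: contraNneq gk => ->.
  rewrite D2E !inE (negPf kg) gk andbT /=.
  case kD: (k \in D) => //=; symmetry; apply/negP.
  case/and4P => kg'; rewrite kg' andbT => kU /no_outP ko /no_outP ki.
  suff: k \in D :|: U by rewrite inE kD (negPf kU).
  rewrite free; apply/andP; split; apply/no_outP => u uX; apply/negP => /= ku.
    have gu := down _ _ ku gk; suff /ki/negP : u \in D2 by apply.
    rewrite D2E !inE uX gu orbT //.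
  have /ko/negP : u \in U1 by rewrite inE uX (up _ _ ku).
  by apply.
have agreeU k : ~~ Gge e k g -> (k \in U) = (k \in U2).
  move=> kg; rewrite U2E !inE kg andbT.
  case kU: (k \in U) => //=; symmetry; apply/negP.
  case/and4P => gk kD /no_outP ki /no_outP ko.
  suff: k \in D :|: U by rewrite inE kU orbF (agreeD _ gk) (negPf kD).
  rewrite free; apply/andP; split; apply/no_outP => u uX; apply/negP => /= ku.
    have := ki u; rewrite -agreeD ?(down _ _ ku) //= => /(_ uX)/negP; exact.
  have /ko/negP : u \in U2 by apply: sub1; rewrite inE uX (up _ _ ku).
  by apply.
have gD2 : g \in D2 by rewrite D2E !inE eqxx.
have inD2 k : k \in D2 -> no_out (converse e) D2 k.
  rewrite D2E => /orP [|/and4P [] //]; rewrite !inE => kX.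
  apply/no_outP => d dD; apply/negP => /= dk.
  have gk : ~~ Gge e g d.
    case/predU1P: kX => [kE|/andP [_ gk]]; last exact: (down _ _ dk).
    by apply: (edge_not_Gge hl); rewrite -kE.
  move: dD; rewrite -agreeD // => dD.
  have : no_out (converse e) D k.
    by case/predU1P: kX => [->|/andP [/memD/andP [] //]]; case/memU/andP: gU.
  by move/no_outP/(_ d dD)/negP; apply.
have noDU d u : d \in D2 -> u \in U2 -> ~~ e d u.
  move=> dD; rewrite U2E => /orP [uU1|/and4P [_ _ /no_outP H _]]; last exact: H.
  move: dD; rewrite D2E => /orP [|/and4P [_ _ /no_outP H _]]; last exact: H.
  have /andP [uU _] := U1U _ uU1.
  rewrite !inE => /predU1P [->|/andP [/memD/andP [_ /no_outP]]]; last first.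
    by move/(_ _ uU).
  by case/memU/andP: gU => _ /no_outP/(_ _ uU).
apply/and5P; split=> //; last first.
  apply/andP; split; apply/forallP => k; apply/implyP => Hk.
    by rewrite agreeD.
  by rewrite agreeU.
apply/saturatedP; split=> /= [k kD|k].
  rewrite U2E kD /= andbF orbF; apply/negP => kU1.
  have /andP [kU kg] := U1U _ kU1; move: kD.
  rewrite D2E kU1 /= andbF orbF !inE => /predU1P [kE|/andP [/dis]].
    by rewrite kE gg in kg.
  by rewrite kU.
rewrite in_setU; apply/orP/andP => [[kD|kU]|[ki ko]].
- by split; [apply: inD2 | apply/no_outP => u; apply: noDU].
- split; first by apply/no_outP => d dD; apply: noDU.
  move: kU; rewrite U2E => /orP [|/and4P [] //] /U1U /andP [kU kg].
  apply/no_outP => u uU2; apply/negP => ku.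
  have uU : u \in U by rewrite agreeU // (up _ _ ku).
  by case/memU/andP: kU => _ /no_outP/(_ u uU)/negP; apply.
have [gk|gk] := boolP (Gge e g k); last first.
  case kD: (k \in D2); [by left | right].
  by rewrite U2E gk kD ki ko orbT.
case: (eqVneq k g) => [->|kg]; first by left.
have kg' : ~~ Gge e k g.
  by apply: contra kg => kg; apply/eqP; apply: (Gge_anti hl).
case kU1: (k \in U1); first by right; apply: sub1.
left; rewrite D2E kg' kU1 ki (no_outS _ ko) ?orbT //.
by apply/subsetP.
Qed.

(** If an unblocked vertex k lay outside D and U, then k could replace the
    elements of D to which it has an edge, or be added to D if there are none.
    Conversely, a vertex d that can be inserted in D after removing smaller
    elements is unblocked in (D, U), since smaller elements have no edge to
    d. *)
Lemma is_top_saturated p : is_top e p = saturated e p.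
Proof.
case: p => D U; apply/idP/idP.
  case/andP => /and4P [/= /forall_inP iD /forall_inP iU dis /forall_inP iDU].
  case/and4P => /forall_inP t1 _ /forall_inP t3 _.
  apply/saturatedP; split=> /= [k kD|k]; first by rewrite (disjointFr dis kD).
  apply/setUP/andP => [[kD|kU]|[/no_outP ki /no_outP ko]].
  - split; apply/no_outP => u uX; first by move/forall_inP: (iD u uX); apply.
    by move/forall_inP: (iDU k kD); apply.
  - split; apply/no_outP => u uX; first by move/forall_inP: (iDU u uX); apply.
    by move/forall_inP: (iU k kU); apply.
  case kD: (k \in D); [by left | right].
  apply/negPn/negP => kU.
  pose A := [set d in D | e k d].
  have orth : orthogonal e (k |: (D :\: A), U).
    apply/and4P; split=> /=.
    - apply/forall_inP => x xX; apply/forall_inP => y yX; apply/negP => xy.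
      move: xX yX; rewrite !inE => /predU1P [xk|/andP [xA xD]].
        subst x; case/predU1P => [yk|].
          by subst y; rewrite (edge_irr hl) in xy.
        by rewrite xy andbT; case: (y \in D).
      case/predU1P => [yk|/andP [_ yD]].
        by subst y; move/negP: (ki x xD); apply.
      by move/forall_inP/(_ y yD)/negP: (iD x xD); apply.
    - by apply/forall_inP.
    - rewrite disjoint_subset; apply/subsetP => x; rewrite !inE.
      case/predU1P => [-> //|/andP [_ xD]].
      by rewrite (disjointFr dis xD).
    apply/forall_inP => x; rewrite !inE => /predU1P [->|/andP [_ /iDU //]].
    by apply/forall_inP => u /ko.
  have [A0|A0] := eqVneq A set0.
    have := t3 k (negbT kD).
    by rewrite A0 setD0 in orth; rewrite orth.
  have /forall_inP /(_ A) := t1 k (negbT kD).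
  rewrite orth => H; suff: ~~ true by []; apply: H; rewrite A0 /=.
  apply/andP; split; first by apply/subsetP => x; rewrite inE => /andP [].
  apply/forall_inP => x; rewrite inE => /andP [_ kx].
  rewrite /Ggt /Gge connect1 // andbT; apply: contraTneq kx => ->.
  by rewrite (edge_irr hl).
move=> sp; have [/= dis free] := elimT (saturatedP e (D, U)) sp.
have memD k : k \in D -> no_out (converse e) D k && no_out e U k.
  by move=> kD; rewrite -free inE kD.
have memU k : k \in U -> no_out (converse e) D k && no_out e U k.
  by move=> kU; rewrite -free inE kU orbT.
have orth : orthogonal e (D, U).
  apply/and4P; split=> /=.
  - apply/forall_inP => x xD; apply/forall_inP => y.
    by case/memD/andP => /no_outP H _; apply: H.
  - by apply/forall_inP => x /memU /andP [_ /no_outP H]; apply/forall_inP.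
  - by rewrite disjoint_subset; apply/subsetP => x /dis.
  by apply/forall_inP => x /memD /andP [_ /no_outP H]; apply/forall_inP.
have max1 d A : d \notin D -> (forall x, x \in A -> Ggt e d x) ->
    ~~ orthogonal e (d |: (D :\: A), U).
  move=> dD dA; apply/negP => /and4P [/= /forall_inP iD _ di /forall_inP iDU].
  have dX : d \in d |: (D :\: A) by rewrite !inE eqxx.
  suff : d \in D :|: U by rewrite inE (negPf dD) (disjointFr di).
  rewrite free; apply/andP; split; apply/no_outP => u uX; last first.
    by move/forall_inP: (iDU d dX); apply.
  case uA: (u \in A); last first.
    have uD : u \in d |: (D :\: A) by rewrite !inE uA uX orbT.
    by move/forall_inP: (iD u uD); apply.
  apply/negP => /(edge_not_Gge hl); case/andP: (dA _ uA) => _ -> //.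
have max2 u A : u \notin U -> (forall x, x \in A -> Ggt e x u) ->
    ~~ orthogonal e (D, u |: (U :\: A)).
  move=> uU uA; apply/negP => /and4P [/= _ /forall_inP iU di /forall_inP iDU].
  have uX : u \in u |: (U :\: A) by rewrite !inE eqxx.
  suff : u \in D :|: U by rewrite inE (negPf uU) (disjointFl di).
  rewrite free; apply/andP; split; apply/no_outP => x xX.
    by move/forall_inP: (iDU x xX); apply.
  case xA: (x \in A); last first.
    have xU : x \in u |: (U :\: A) by rewrite !inE xA xX orbT.
    by move/forall_inP: (iU u uX); apply.
  apply/negP => /(edge_not_Gge hl); case/andP: (uA _ xA) => _ -> //.
rewrite /is_top orth /=; apply/and4P; split; apply/forall_inP => d dX.
- by apply/forall_inP => A /and3P [_ _ /forall_inP H]; apply: max1.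
- by apply/forall_inP => A /and3P [_ _ /forall_inP H]; apply: max2.
- by rewrite -[D in d |: D]setD0; apply: max1 => // x; rewrite inE.
by rewrite -[U in d |: U]setD0; apply: max2 => // x; rewrite inE.
Qed.

Lemma top_le_steps (x y : top e) : top_le e l l' x y = steps e (val x) (val y).
Proof.
apply/idP/idP.
  case/connectP => s; elim: s x => [|z s IHs] x /=.
    by move=> _ ->; apply: connect0.
  case/andP => /existsP [g /andP [gU /eqP zE]] sP yE.
  apply: connect_trans (IHs z sP yE); apply: connect1; apply/existsP.
  exists g; rewrite zE; apply: flip_step => //.
  by rewrite -is_top_saturated (valP x).
case/connectP => s; elim: s x => [|q s IHs] x /=.
  by move=> _ /val_inj ->; apply: connect0.
case/andP => /existsP [g st] sP yE.
have [sx sq gU _ _] := stepP st.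
have tq : is_top e q by rewrite is_top_saturated.
pose z : top e := Sub q tq.
have sP' : path (fun p q => [exists g, step e g p q]) (val z) s by [].
apply: connect_trans (IHs z sP' yE); apply: connect1; apply/existsP; exists g.
rewrite gU /=; apply/eqP; apply: (step_unique st).
exact: flip_step.
Qed.

End Flips.

(** * Overlapping graphs and forbidden partitions *)

Section Overlap.
Variables (T : finType) (e : rel T).
Implicit Types (A B X Y : {set T}).

(** Between closed sets X < X' there is a vertex of X' unrelated to all of X. *)
Definition overlapping := forall Y Y', perp e Y \proper perp e Y' ->
  exists2 k, k \in perp e Y' & k \in perp (converse e) (perp e Y).

(** For closed sets X < X' with X' disjoint from perp' X, a vertex of X' \ X is
    outside X = perp (perp' X), so it has an edge to perp' X, necessarily
    outside perp' X'; the other edges required of the partition arise in the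
    same way. *)
Lemma no_forbidden_overlapping :
  ~ (exists X1 X2 X3 X4 Z : {set T}, forbidden_partition e X1 X2 X3 X4 Z) ->
  overlapping.
Proof.
move=> nf Y Y' ltY.
have [/exists_inP //|/exists_inPn dis] :=
  boolP [exists k in perp e Y', k \in perp (converse e) (perp e Y)].
case: nf; have [sub [x0 x0X' x0X]] := properP ltY.
have XW := perpK e Y; have XW' := perpK e Y'.
have subW := perpS (converse e) sub.
move: (perp e Y) (perp e Y') {ltY} => X X' in sub x0X' x0X dis XW XW' subW *.
have nW' k : k \notin perp (converse e) X' ->
    exists2 h, h \in X' & (k == h) || e h k by apply: notin_perpP.
have nW k : k \notin perp (converse e) X ->
    exists2 h, h \in X & (k == h) || e h k by apply: notin_perpP.
move: (perp (converse e) X) (perp (converse e) X') => W W'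
  in dis XW XW' subW nW nW' *.
have nX k : k \notin X -> exists2 h, h \in W & (k == h) || e k h.
  by rewrite -XW; apply: notin_perpP.
have nX' k : k \notin X' -> exists2 h, h \in W' & (k == h) || e k h.
  by rewrite -XW'; apply: notin_perpP.
have noXW g h : g \in X -> h \in W -> ~~ e g h.
  by rewrite -XW => /perpP H /H /andP [].
have noXW' g h : g \in X' -> h \in W' -> ~~ e g h.
  by rewrite -XW' => /perpP H /H /andP [].
have dX h : h \in W -> h \notin X'.
  by move=> hW; apply/negP => /dis; rewrite hW.
have sW h : h \in W' -> h \in W by apply/subsetP.
have sX h : h \in X -> h \in X' by apply/subsetP.
have P3 x : x \in X' :\: X ->
    (exists2 y, y \in X & e y x) /\ (exists2 y, y \in W :\: W' & e x y).
  case/setDP => xX' xX; split.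
    have [h hX /orP [/eqP xh|]] := nW _ (dis x xX'); last by exists h.
    by rewrite xh hX in xX.
  have [h hW /orP [/eqP xh|xh]] := nX _ xX.
    by move: (dis _ xX'); rewrite xh hW.
  by exists h => //; rewrite inE hW andbT; apply: contraL xh; apply: noXW'.
have P2 x : x \in W :\: W' ->
    (exists2 y, y \in W' & e x y) /\ (exists2 y, y \in X' :\: X & e y x).
  case/setDP => xW xW'; split.
    have [h hW /orP [/eqP xh|]] := nX' _ (dX x xW); last by exists h.
    by rewrite xh hW in xW'.
  have [h hX /orP [/eqP xh|xh]] := nW' _ xW'.
    by move: (dX _ xW); rewrite xh hX.
  exists h => //; rewrite inE hX andbT; apply: contraL xh => hX0.
  exact: noXW.
have x03 : x0 \in X' :\: X by rewrite inE x0X.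
have [[x4 x44 _] [x2 x22 _]] := P3 _ x03; have [[x1 x11 _] _] := P2 _ x22.
exists W', (W :\: W'), (X' :\: X), X, (~: (X' :|: W)); split; last first.
  split=> //.
  - by split; apply/set0Pn; [exists x1|exists x2|exists x0|exists x4].
  - split=> g h.
    + by move=> gX /setDP [hW _]; apply: noXW.
    + by move=> gX /sW; apply: noXW.
    by move=> /setDP [gX _]; apply: noXW'.
  move=> x; rewrite !inE negb_or => /andP [xX' xW]; split.
    have [h hX /orP [/eqP xh|]] := nW _ xW; last by exists h.
    by rewrite xh (sX _ hX) in xX'.
  have [h hX /orP [/eqP xh|]] := nX' _ xX'; last by exists h.
  by rewrite xh (sW _ hX) in xW.
split; last first.
  rewrite !big_cons big_nil; apply/setP => x; rewrite !inE.
  case: (boolP (x \in W')) => //= _; case: (x \in W) => //=.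
  by rewrite orbF; case: (x \in X) => //=; case: (x \in X').
have disj A B : (forall x, x \in A -> x \notin B) -> [disjoint A & B].
  by move=> H; rewrite disjoint_subset; apply/subsetP => x /H.
rewrite /= !andbT; repeat (apply/andP; split); apply: disj => x; rewrite ?inE.
- by move=> ->.
- by move=> /sW/dX/negPf ->; rewrite andbF.
- by move=> /sW/dX xX'; apply: contra xX'; apply: sX.
- by move=> /sW ->; rewrite orbT.
- by case/andP => _ /dX/negPf ->; rewrite andbF.
- by case/andP => _ /dX; apply: contra; apply: sX.
- by case/andP => _ ->; rewrite orbT.
- by case/andP.
- by case/andP => _ ->.
by move/sX ->.
Qed.

(** The edges imposed by a forbidden partition are what keeps X2, X3 and Z out
    of these polar sets, and the excluded edges are what lets X4 and X3 in. *)
Lemma forbidden_closed X1 X2 X3 X4 Z : forbidden_partition e X1 X2 X3 X4 Z ->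
  [/\ perp e (X1 :|: X2) = X4, perp e X1 = X3 :|: X4,
      exists2 x, x \in X3 & x \notin X4 &
      forall x, x \in perp (converse e) X4 -> x \notin X3 :|: X4].
Proof.
case=> -[dis cover] [[_ _ /set0Pn [x0 x03] _] P3 P2 [no42 no41 no31] PZ].
have cov x : [|| x \in X1, x \in X2, x \in X3, x \in X4 | x \in Z].
  by move/setP/(_ x): cover; rewrite !big_cons big_nil !inE orbF.
have [d13 d14 d24 d34] : [/\ [disjoint X1 & X3], [disjoint X1 & X4],
    [disjoint X2 & X4] & [disjoint X3 & X4]].
  move: dis; rewrite /= !andbT.
  by case/and4P => /and4P [_ -> -> _] /and3P [_ -> _] /andP [-> _] _.
have neq A B x h : [disjoint A & B] -> h \in A -> x \in B -> x != h.
  by move=> dAB hA; apply: contraTneq => ->; rewrite (disjointFr dAB).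
split.
- apply/setP => x; apply/perpP/idP => [H|x4 h].
    case/or4P: (cov x) => [x1|x2|x3|/orP [//|xZ]].
    + by have := H x; rewrite inE x1 eqxx => /(_ isT).
    + by have := H x; rewrite inE x2 orbT eqxx => /(_ isT).
    + have [_ [y y2 xy]] := P3 x x3.
      by have := H y; rewrite inE y2 orbT xy andbF => /(_ isT).
    have [_ [y y1 xy]] := PZ x xZ.
    by have := H y; rewrite inE y1 xy andbF => /(_ isT).
  rewrite inE => /orP [hX|hX].
    by rewrite no41 // (neq _ _ _ _ d14).
  by rewrite no42 // (neq _ _ _ _ d24).
- apply/setP => x; apply/perpP/setUP => [H|x34 h h1].
    case/or4P: (cov x) => [x1|x2|x3|/orP [x4|xZ]]; [| |by left|by right|].
    + by have := H x x1; rewrite eqxx.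
    + by have [[y y1 xy] _] := P2 x x2; have := H y y1; rewrite xy andbF.
    by have [_ [y y1 xy]] := PZ x xZ; have := H y y1; rewrite xy andbF.
  case: x34 => xX.
    by rewrite no31 // (neq _ _ _ _ d13).
  by rewrite no41 // (neq _ _ _ _ d14).
- by exists x0; rewrite ?(disjointFr d34).
move=> x /perpP H; rewrite inE negb_or; apply/andP; split; apply/negP => xX.
  have [[y y4 yx] _] := P3 x xX.
  by have := H y y4; rewrite /converse yx andbF.
by have := H x xX; rewrite eqxx.
Qed.

End Overlap.

(** * Overlapping graphs give lattices *)

Section Polars.
Variables (T : finType) (e : rel T) (l l' : seq T).
Hypotheses (hl : linear_extension e l) (hl' : linear_extension (converse e) l').
Implicit Types (p q : {set T} * {set T}).

Lemma perp_inj p q :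
  saturated e p -> saturated e q -> perp e p.2 = perp e q.2 -> p = q.
Proof.
move=> sp sq eqX; apply: (saturated_inj1 hl) => //.
apply: (kernel_unique hl' (X := perp e p.2)) => k.
  exact: saturated_mem1.
by rewrite eqX; apply: saturated_mem1.
Qed.

(** Half of the recognition of a step from polar sets. Suppose that k is not
    above g and that U and U' agree on the vertices to which k has an edge. If
    they differ at k, then k is in perp' D but not in perp' D', and it has no
    edge to U'. So k is in perp U' but not in perp U, hence above g. *)
Lemma agree_below p q g : saturated e p -> saturated e q ->
  perp (converse e) q.1 \subset perp (converse e) p.1 ->
  (forall k, k \in perp e q.2 -> k \notin perp e p.2 -> (k == g) || e k g) ->
  g \in perp e q.2 -> g \in perp (converse e) p.1 ->
  (forall k, ~~ Gge e k g -> (k \in p.2) = (k \in q.2)) /\ g \in p.2.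
Proof.
move=> sp sq subY newX gX gY.
have agree k : ~~ Gge e k g -> (k \in p.2) = (k \in q.2).
  elim/(sink_ind hl): k => k IH kg.
  have eqo : no_out e p.2 k = no_out e q.2 k.
    apply: eq_no_out => h kh; apply: IH => //.
    by apply: contra kg; apply: connect_trans (connect1 kh).
  rewrite (saturated_mem2 _ sp) (saturated_mem2 _ sq) eqo.
  have [ko|] := boolP (no_out e q.2 k); last by rewrite !andbF.
  rewrite !andbT; have [kY|kY] := boolP (k \in perp _ q.1).
    exact: (subsetP subY).
  apply/negP => kY'.
  have kX : k \in perp e q.2.
    by rewrite inE ko andbT; apply: contra kY; apply/subsetP/saturated_sub2.
  have kX0 : k \notin perp e p.2 by apply: contraL kY' => /(perp_both sp).
  case/predU1P: (newX k kX kX0) => [kE|kg'].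
    by rewrite kE /Gge connect0 in kg.
  by rewrite /Gge connect1 in kg.
split=> //; rewrite (saturated_mem2 _ sp) gY; apply/no_outP => u uU.
apply/negP => gu; have ug := edge_not_Gge hl gu.
move: uU; rewrite agree // => uU.
by move/perpP: gX => /(_ u uU); rewrite gu andbF.
Qed.

End Polars.

Section OverlapLattice.
Variables (T : finType) (e : rel T) (l l' : seq T).
Hypotheses (hl : linear_extension e l) (hl' : linear_extension (converse e) l').
Hypothesis ov : overlapping e.
Implicit Types (X Y : {set T}) (p q : {set T} * {set T}).

(** The inclusion from left to right always holds, and [perp_both] says that
    the overlap of these two closed sets is empty. *)
Lemma perp_perp p :
  saturated e p -> perp e (perp (converse e) p.1) = perp e p.2.
Proof.
move=> sp; have sub := perpS e (saturated_sub2 sp).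
apply/eqP; move: sub; rewrite subEproper => /predU1P [-> //|/ov [k kU]].
by rewrite (perpK (converse e)) (negPf (perp_both sp kU)).
Qed.

Lemma perp_perp' p :
  saturated e p -> perp (converse e) (perp e p.2) = perp (converse e) p.1.
Proof. by move=> /perp_perp <-; apply: (perpK (converse e)). Qed.

(** Take for D the kernel K of the reversed graph on X = perp Y: an element of
    X unrelated to K would belong to K, so overlap forces the closure of K to
    be X. *)
Lemma closed_saturated Y : exists2 p, saturated e p & perp e p.2 = perp e Y.
Proof.
pose K := kernel (converse e) l' (perp e Y).
have KP k : (k \in K) = (k \in perp e Y) && no_out (converse e) K k.
  exact: kernelP.
have sp : saturated e (complete e l K).
  by apply: saturated_complete => //; apply: kernel_independent.
exists (complete e l K) => //; rewrite -perp_perp //=.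
have sub : perp e (perp (converse e) K) \subset perp e Y.
  rewrite -(perpK e Y); do 2!apply: perpS.
  by apply/subsetP => k; rewrite KP => /andP [].
apply/eqP; move: sub; rewrite subEproper => /predU1P [-> //|/ov [k kX]].
rewrite (perpK (converse e)) inE => /andP [kK ki].
by rewrite KP kX ki in kK.
Qed.

(** Let X and X' be the closed sets of p and q. If X were not contained in X',
    overlap would give k in X unrelated to X :&: X'. Such a k is above g, since
    U is unchanged elsewhere, and receives no edge from D, since an element of
    D with an edge to k is above g and so belongs to X :&: X'. Thus k is in D
    and above g, hence still in D after the step, hence in X'. *)
Lemma step_perp g p q : step e g p q -> perp e p.2 \subset perp e q.2.
Proof.
case/stepP => sp sq gp gq [agD agU].
apply/setIidPl/eqP; rewrite -perpU; apply/negPn/negP => neq.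
have [|k kX] := @ov (p.2 :|: q.2) p.2.
  by rewrite properEneq neq perpS ?subsetUl.
rewrite perpU => /perpP kI.
have kX' : k \notin perp e q.2.
  by apply/negP => kX'; move: (kI k); rewrite inE kX kX' eqxx => /(_ isT).
have subD := subsetP (saturated_sub1 sp).
have subD' := subsetP (saturated_sub1 sq).
have kg : Gge e k g.
  apply: contraNT kX' => kg; apply/perpP => u uU.
  have ug : (k == u) || e k u -> ~~ Gge e u g.
    case/predU1P => [<- //|ku]; apply: contra kg.
    exact: connect_trans (connect1 ku).
  rewrite -negb_or; apply/negP => ku.
  move: uU; rewrite -agU ?ug // => uU.
  by move/perpP: kX => /(_ u uU); rewrite -negb_or ku.
have gD : g \notin p.1.
  by apply: contraL gp => /(proj1 (elimT (saturatedP _ _) sp)).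
have kD : k \in p.1.
  rewrite (saturated_mem1 _ sp) kX; apply/no_outP => d dD; apply/negP => /= dk.
  have gd : ~~ Gge e g d.
    apply: contraNN gD => gd; rewrite (Gge_anti hl gd) //.
    exact: connect_trans (connect1 (dk : e d k)) kg.
  have dD' : d \in q.1 by rewrite -agD.
  by have := kI d; rewrite inE subD // subD' // dk andbF => /(_ isT).
have gk : ~~ Gge e g k.
  by apply: contraNN gD => gk; rewrite (Gge_anti hl gk kg).
by move: kX'; rewrite subD' // -agD.
Qed.

(** Pick g in the overlap. No closed set lies strictly between, so removing
    from the larger set the vertices related to g gives the smaller one, and
    adding g to the smaller one generates the larger one. These are the
    hypotheses of [agree_below] for U and, on the reversed graph, for D. *)
Lemma minimal_step p q : saturated e p -> saturated e q ->
  perp e p.2 \proper perp e q.2 ->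
  (forall Y, perp e p.2 \proper perp e Y -> perp e Y \subset perp e q.2 ->
             perp e Y = perp e q.2) ->
  exists g, step e g p q.
Proof.
move=> sp sq pq min; have [g gX gY] := ov pq; exists g.
have gX0 : g \notin perp e p.2.
  by apply/negP => gX0; move/perpP: gY => /(_ g gX0); rewrite eqxx.
have sub := proper_sub pq.
have newX k : k \in perp e q.2 -> k \notin perp e p.2 -> (k == g) || e k g.
  move=> kX kX0; apply: contraNT kX0; rewrite negb_or => kg.
  suff -> : perp e p.2 = perp e (q.2 :|: [set g]).
    by rewrite perpU inE kX; apply/perpP => h /set1P ->.
  have subI : perp e p.2 \subset perp e (q.2 :|: [set g]).
    by rewrite perpU subsetI sub perp_galois sub1set.
  apply/eqP/negPn/negP => neq.
  have := min (q.2 :|: [set g]); rewrite properEneq neq subI => /(_ isT).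
  rewrite perpS ?subsetUl // => /(_ isT)/setP/(_ g).
  rewrite gX => /perpP/(_ g); rewrite inE set11 orbT eqxx => /(_ isT) //.
have sub' : perp (converse e) q.1 \subset perp (converse e) p.1.
  by rewrite -!perp_perp' // perpS.
have oldY k : k \in perp (converse e) p.1 -> k \notin perp (converse e) q.1 ->
    (k == g) || e g k.
  rewrite -!perp_perp' // => kY kY'.
  apply: contraNT kY'; rewrite negb_or => kg.
  pose Y := perp (converse e) (perp e p.2 :|: [set g]).
  have EX : perp e Y = perp e q.2.
    apply: min; last first.
      rewrite -(perpK e q.2); do 2!apply: perpS.
      by rewrite subUset sub sub1set.
    rewrite properE -{1}(perpK e p.2) perpS ?(perpS (converse e)) ?subsetUl //=.
    apply: contra gX0 => /subsetP; apply; rewrite -sub1set.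
    by rewrite perp_galois /Y perpS ?subsetUr.
  rewrite -EX (perpK (converse e)) /Y perpU inE kY.
  by apply/perpP => h /set1P ->.
have gY' := gY; rewrite perp_perp' // in gY'.
have [agU gU] := agree_below hl sp sq sub' newX gX gY'.
rewrite -!(saturated_converse e) in sp sq.
have [agD gD] := agree_below hl' sq sp sub oldY gY' gX.
rewrite !saturated_converse in sp sq.
apply/and5P; split=> //; apply/andP; split; apply/forallP => k; apply/implyP.
  by move=> gk; rewrite (agD k) // Gge_converse.
by move=> gk; rewrite agU.
Qed.

Lemma steps_perp p q : saturated e p -> saturated e q ->
  steps e p q = (perp e p.2 \subset perp e q.2).
Proof.
move=> sp sq; apply/idP/idP.
  case/connectP => s; elim: s p {sp} => [|r s IHs] p /=; first by move=> _ ->.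
  case/andP => /existsP [g /step_perp pr] rs /(IHs _ rs).
  exact: subset_trans.
have [n] := ubnP (#|perp e q.2| - #|perp e p.2|).
elim: n p sp => // n IHn p sp; rewrite ltnS => le_n.
rewrite subEproper => /predU1P [|pq].
  by move/(perp_inj hl hl' sp sq) ->; apply: connect0.
pose P Y := (perp e p.2 \proper perp e Y) && (perp e Y \subset perp e q.2).
have Pq : P q.2 by rewrite /P pq subxx.
case: (arg_minnP (fun Y => #|perp e Y|) Pq) => Y /andP [pY Yq] minY.
have [r sr rY] := closed_saturated Y.
rewrite -rY in pY Yq minY.
have [g /step_steps pr] : exists g, step e g p r.
  apply: minimal_step => // Y' pY' Y'r; apply/eqP; rewrite eqEcard Y'r.
  by apply: minY; rewrite /P pY' (subset_trans Y'r).
apply: connect_trans pr (IHn _ sr _ Yq).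
apply: leq_trans le_n; apply: ltn_sub2l; last exact: proper_card.
exact: proper_card.
Qed.

Theorem overlapping_lattice : is_lattice (top_le e l l').
Proof.
pose hi (x : top e) := perp e (val x).2.
have sat (x : top e) : saturated e (val x).
  by rewrite -(is_top_saturated hl) (valP x).
have leE x y : top_le e l l' x y = (hi x \subset hi y).
  by rewrite (top_le_steps hl hl') steps_perp.
have ex Y : exists x, hi x = perp e Y.
  have [p sp pY] := closed_saturated Y.
  have tp : is_top e p by rewrite (is_top_saturated hl).
  by exists (Sub p tp).
split.
- by move=> x; rewrite leE.
- move=> x y; rewrite !leE -eqEsubset => /eqP xy.
  by apply/val_inj/(perp_inj hl hl').
- by move=> y x z; rewrite !leE; apply: subset_trans.
- move=> x y; have [m mE] := ex ((val x).2 :|: (val y).2).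
  rewrite perpU in mE; exists m; split; rewrite ?leE ?mE ?subsetIl ?subsetIr //.
  by move=> z; rewrite !leE mE subsetI => -> ->.
move=> x y; have [j jE] := ex (perp (converse e) (hi x :|: hi y)).
have cl : hi x :|: hi y \subset hi j by rewrite jE perp_galois.
exists j; split.
- by rewrite leE (subset_trans _ cl) ?subsetUl.
- by rewrite leE (subset_trans _ cl) ?subsetUr.
move=> z; rewrite !leE => xz yz; rewrite jE.
have -> : hi z = perp e (perp (converse e) (hi z)) by rewrite /hi perpK.
by do 2!apply: perpS; rewrite subUset xz yz.
Qed.

End OverlapLattice.

(** * Comparing tops in an arbitrary graph *)

Section Descend.
Variables (T : finType) (e : rel T) (l l' : seq T).
Hypotheses (hl : linear_extension e l) (hl' : linear_extension (converse e) l').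
Implicit Types (P S : {set T}) (p q j : {set T} * {set T}).

Lemma step_down p g : saturated e p -> g \in p.1 -> exists q, step e g q p.
Proof.
rewrite -saturated_converse => sp gp.
exists (swap (flip (converse e) l' l g (swap p))).
by rewrite -step_converse swapK flip_step.
Qed.

(** Stepping down at g leaves D unchanged off the vertices below g, so clearing
    D of the elements of S from the last one to the first one of the linear
    extension never brings back a vertex already dealt with. *)
Lemma descend S (I : {set T} * {set T} -> Prop) :
  (forall p q g, step e g q p -> g \in S -> I p -> I q) ->
  forall p, saturated e p -> I p ->
  exists q, [/\ saturated e q, I q, steps e q p &
                forall k, k \in q.1 -> k \notin S].
Proof.
move=> stepI p sp Ip.
have H n : exists q, [/\ saturated e q, I q, steps e q p &
    forall k, k \in q.1 -> k \in S -> index k l < size l - n].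
  elim: n => [|n [q [sq Iq qp qS]]].
    exists p; split=> //; first exact: connect0.
    by move=> k _ _; rewrite subn0 index_mem (ext_mem hl).
  have qS' k : k \in q.1 -> k \in S -> index k l <= size l - n.+1.
    by move=> kq /(qS k kq); rewrite subnS; case: (size l - n).
  have [/exists_inP [g gD /andP [gS /eqP gn]]|/exists_inPn no] :=
    boolP [exists g in q.1, (g \in S) && (index g l == size l - n.+1)].
    have [r rq] := step_down sq gD.
    have [sr _ gr _ [agD _]] := stepP rq.
    exists r; split=> //.
    - exact: stepI rq gS Iq.
    - exact: connect_trans (step_steps rq) qp.
    move=> k kr kS; rewrite -gn ltnNge; apply/negP => gk.
    have kg : index k l <= index g l.
      have [/(Gge_index hl) //|gk'] := boolP (Gge e g k).
      by rewrite gn qS' // -agD.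
    have eq_i : index k l = index g l by apply/eqP; rewrite eqn_leq gk kg.
    have kE : k = g.
      by rewrite -(nth_index g (ext_mem hl k)) eq_i nth_index ?(ext_mem hl).
    have /saturatedP [dis _] := sr.
    by move/dis: kr; rewrite kE gr.
  exists q; split=> // k kq kS.
  by have := qS' k kq kS; have := no k kq; rewrite kS /= ltn_neqAle => ->.
have [q [sq Iq qp qS]] := H (size l).
exists q; split=> // k kq; apply/negP => /(qS k kq).
by rewrite subnn.
Qed.

(** Step down first at the vertices strictly above g: U does not change below
    g, so g remains in perp U, and at the end nothing in D is above g, which
    forces g in D. Then step down at all vertices other than g: none of them is
    above g, so g stays in D, and at the end D = {g}. *)
Lemma steps_generator g p j : saturated e p -> g \in perp e p.2 ->
  saturated e j -> j.1 = [set g] -> steps e j p.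
Proof.
move=> sp gp sj jE.
pose above : {set T} := [set d | Ggt e d g].
have [||q [sq gq qp qS]] :=
  @descend above (fun p => g \in perp e p.2) _ p sp.
- move=> p1 p2 d /stepP [_ _ _ _ [_ agU]]; rewrite inE => /andP [dg dg'].
  move=> /perpP H; apply/perpP => u uU; rewrite -negb_or; apply/negP => gu.
  have ud : ~~ Gge e u d.
    apply: contraNN dg => ud; rewrite eq_sym; apply/eqP.
    have gu' : Gge e g u.
      by case/predU1P: gu => [->|/connect1 //]; apply: connect0.
    by apply: (Gge_anti hl) dg'; apply: connect_trans gu' ud.
  by move: uU; rewrite agU // => /H; rewrite -negb_or gu.
- by [].
have Dq k : k \in q.1 -> ~~ Ggt e k g by move/qS; rewrite inE.
have gD : g \in q.1.
  rewrite (saturated_mem1 _ sq) gq; apply/no_outP => d /Dq dg.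
  apply/negP => /= gd; move/negP: dg; apply.
  rewrite /Ggt /Gge connect1 // andbT.
  by apply: contraTneq gd => ->; rewrite /converse (edge_irr hl).
pose top_g p := g \in p.1 /\ forall k, k \in p.1 -> ~~ Ggt e k g.
have [||r [sr [gr Dr] rq rS]] := @descend [set~ g] top_g _ q sq.
- move=> p1 p2 d st; have [_ _ _ dD [agD _]] := stepP st.
  rewrite !inE => dg [gD1 D1].
  have dg' : ~~ Gge e d g by have := D1 d dD; rewrite /Ggt dg.
  split=> [|k kD]; first by rewrite agD.
  apply/negP => kg; suff /D1 : k \in p1.1 by rewrite kg.
  rewrite -agD //; apply: contra dg' => dk.
  by case/andP: kg => _; apply: connect_trans.
- by split.
suff -> : j = r by apply: connect_trans qp.
apply: (saturated_inj1 hl) => //; rewrite jE; apply/eqP.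
rewrite eqEsubset sub1set gr /=; apply/subsetP => k /rS.
by rewrite !inE negbK.
Qed.

Lemma steps_upset P p q : (forall k h, k \in P -> Gge e k h -> h \in P) ->
  steps e p q -> (forall k, k \in P -> k \notin p.2) ->
  (forall k, k \in P -> k \notin q.2).
Proof.
move=> Pdown /connectP [s]; elim: s p => [|r s IHs] p /=; first by move=> _ ->.
case/andP => /existsP [g /stepP [_ _ gp _ [_ agU]]] rs qE H; apply: IHs rs qE _.
move=> k kP; rewrite -agU ?H //; apply: contraL gp => kg; apply: H.
exact: Pdown kg.
Qed.

End Descend.

Section Duals.
Variables (T : finType) (e : rel T) (l l' : seq T).
Hypotheses (hl : linear_extension e l) (hl' : linear_extension (converse e) l').
Implicit Types (P : {set T}) (p q j m : {set T} * {set T}).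

Lemma steps_cogenerator h p m : saturated e p -> h \in perp (converse e) p.1 ->
  saturated e m -> m.2 = [set h] -> steps e p m.
Proof.
rewrite -steps_converse -!(saturated_converse e) => sp hp sm mE.
exact: (steps_generator hl' hl sp hp sm mE).
Qed.

Lemma steps_downset P p q : (forall k h, k \in P -> Gge e k h -> h \in P) ->
  steps e p q -> q.1 \subset P -> p.1 \subset P.
Proof.
move=> Pdown; rewrite -steps_converse => pq /subsetP qP; apply/subsetP => k.
apply: contraTT => kP; apply: (steps_upset (P := ~: P)) pq _ _ _.
- move=> x y; rewrite !inE Gge_converse => xP yx; apply: contra xP => yP.
  exact: Pdown yx.
- by move=> x; rewrite inE; apply: contra; apply: qP.
by rewrite inE.
Qed.

Definition has_joins := forall p q, saturated e p -> saturated e q ->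
  exists w, [/\ steps e p w, steps e q w &
    forall z, saturated e z -> steps e p z -> steps e q z -> steps e w z].

Definition has_meets := forall p q, saturated e p -> saturated e q ->
  exists w, [/\ saturated e w, steps e w p, steps e w q &
    forall z, saturated e z -> steps e z p -> steps e z q -> steps e z w].

(** Let P be the set of vertices strictly below g, and x -> y the flip at g
    where x has D contained in P and U disjoint from P. Then j <= y and x <= m.
    If moreover j <= m, the join w of x and j is below both y and m, and it
    differs from x because j is not below x. A first step up from x towards w
    is at a vertex of U that is g or below g, that is at g, and so leads to y.
    Hence y <= m; but no vertex of P or g can reappear in U above y. *)
Lemma generator_not_below j m g : has_joins -> saturated e j ->
  saturated e m -> j.1 = [set g] -> m.2 = [set g] -> ~~ steps e j m.
Proof.
move=> joins sj sm jE mE; apply/negP => jm.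
pose P := [set k | Ggt e g k]; pose Pg := [set k | Gge e g k].
have PgE k : k \in Pg -> k != g -> k \in P.
  by rewrite !inE /Ggt eq_sym => -> ->.
have downPg k h : k \in Pg -> Gge e k h -> h \in Pg.
  by rewrite !inE; apply: connect_trans.
have downP k h : k \in P -> Gge e k h -> h \in P.
  rewrite !inE => /andP [gk gk'] kh.
  rewrite /Ggt /Gge (connect_trans gk' kh) andbT.
  apply: contraNneq gk => gh; rewrite -gh in kh.
  by rewrite (Gge_anti hl gk' kh).
have PPg : P \subset Pg by apply/subsetP => k; rewrite !inE => /andP [].
have gP : g \notin P by rewrite inE /Ggt eqxx.
have gPg : g \in Pg by rewrite inE /Gge connect0.
pose D := kernel (converse e) l' P.
have DE k : (k \in D) = (k \in P) && no_out (converse e) D k by apply: kernelP.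
have DP : D \subset P by apply: kernel_sub.
pose x := complete e l D.
have sx : saturated e x.
  by apply: saturated_complete => //; apply: kernel_independent.
have xP k : k \in P -> k \notin x.2.
  move=> kP; apply/negP; rewrite (saturated_mem2 _ sx) inE /= DE kP /=.
  by case: (no_out _ D k).
have gx : g \in x.2.
  have /saturatedP [_ free] := sx.
  have : g \in x.1 :|: x.2.
    rewrite free; apply/andP; split; apply/no_outP => u uX; apply/negP => gu.
      have /andP [_ gu'] : Ggt e g u by move/(subsetP DP): uX; rewrite inE.
      by move/negP: (edge_not_Gge hl gu); apply.
    move: (xP u); rewrite uX => /(_ _)/negP; case=> //.
    rewrite inE /Ggt /Gge connect1 // andbT.
    by apply: contraTneq gu => <-; rewrite (edge_irr hl).
  by rewrite inE => /orP [/(subsetP DP)|//]; rewrite (negPf gP).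
pose y := flip e l l' g x; have xy : step e g x y by apply: flip_step.
have [_ sy _ gy [agD agU]] := stepP xy.
have yP : y.1 \subset Pg.
  apply/subsetP => k; apply: contraTT => kP.
  rewrite -agD; last by rewrite inE in kP.
  by apply: contra kP => kD; apply/(subsetP PPg)/(subsetP DP).
have yPg k : k \in Pg -> k \notin y.2.
  have /saturatedP [dis _] := sy.
  case: (eqVneq k g) => [->|kg] kP; first exact: dis.
  rewrite -agU; first by apply/xP/PgE.
  by apply: contra kg => kg; rewrite inE in kP; rewrite (Gge_anti hl kg kP).
have jy : steps e j y.
  apply: (steps_generator hl hl' sy _ sj jE).
  exact: (subsetP (saturated_sub1 sy)).
have xm : steps e x m.
  apply: (steps_cogenerator sx _ sm mE).
  exact: (subsetP (saturated_sub2 sx)).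
have [w [xw jw least]] := joins x j sx sj.
have wy := least y sy (step_steps xy) jy.
have wm := least m sm xm jm.
case/connectP: xw => -[|z s] /=.
  move=> _ wx; rewrite wx in jw.
  have := steps_downset downP jw DP; rewrite jE sub1set (negPf gP) //.
case/andP => /existsP [u xz] zs wE.
have zw : steps e z w by apply/connectP; exists s.
have [_ _ ux uz _] := stepP xz.
have uP : u \in Pg.
  by apply: (subsetP (steps_downset downPg (connect_trans zw wy) yP)).
have ug : u = g.
  apply/eqP; apply: contraLR ux => /(PgE _ uP); exact: xP.
rewrite ug in xz; have zy := step_unique hl hl' xz xy.
have ym : steps e y m by rewrite -zy; apply: connect_trans wm.
by have := steps_upset downPg ym yPg gPg; rewrite mE set11.
Qed.

End Duals.

(** * Counting closed sets *)

Section Counting.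
Variables (T : finType).
Implicit Types (e r : rel T) (X Y : {set T}) (p q : {set T} * {set T}).

Definition closed (r : rel T) := [set perp r Y | Y : {set T}].
Definition saturated_pairs (r : rel T) := [set p | saturated r p].

Lemma leq_saturated_closed e l l' :
  linear_extension e l -> linear_extension (converse e) l' ->
  #|saturated_pairs e| <= #|closed e|.
Proof.
move=> hl hl'.
rewrite -(card_in_imset (f := fun p => perp e p.2)).
  by apply/subset_leq_card/subsetP => X /imsetP [p _ ->]; apply: imset_f.
by move=> p q; rewrite !inE => sp sq; apply: (perp_inj hl hl').
Qed.

Lemma linear_extension_sub e r l :
  subrel r e -> linear_extension e l -> linear_extension r l.
Proof. by move=> re [pl H]; split=> // g h /re; apply: H. Qed.

(** Saturated pairs are counted by their first components, the independent
    sets, and an independent set of [e] is independent for [r]. If an edge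
    g -> h of [e] is missing in [r], then {g, h} is independent only for
    [r]. *)
Lemma saturated_card_sub e r l : linear_extension e l -> subrel r e ->
  #|saturated_pairs e| <= #|saturated_pairs r|
    ?= iff [forall g, forall h, e g h ==> r g h].
Proof.
move=> hl re; have hr := linear_extension_sub re hl.
pose f p := complete r l p.1.
have finj : {in saturated_pairs e &, injective f}.
  move=> p q; rewrite !inE => sp sq [eqD _].
  exact: (saturated_inj1 hl).
have fsub : f @: saturated_pairs e \subset saturated_pairs r.
  apply/subsetP => X /imsetP [p]; rewrite inE => sp ->; rewrite inE.
  apply: saturated_complete => //.
  have /forall_inP ind := independent_saturated sp.
  apply/forall_inP => g gD; apply/forall_inP => h hD.
  by apply: contra (re g h) _; move/forall_inP: (ind g gD); apply.
rewrite -(card_in_imset finj); split; first exact: subset_leq_card.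
apply/eqP/forallP => [card_eq g|H].
  apply/forallP => h; apply/implyP => gh.
  apply/negPn/negP => rgh.
  have eqS : f @: saturated_pairs e = saturated_pairs r.
    by apply/eqP; rewrite eqEcard fsub /= (eq_leq (esym card_eq)).
  have ind : independent r [set g; h].
    apply/forall_inP => a aD; apply/forall_inP => b bD; apply/negP => ab.
    move: aD bD; rewrite !inE => /orP [] /eqP aE /orP [] /eqP bE; subst a b.
    - by rewrite (edge_irr hr) in ab.
    - by rewrite ab in rgh.
    - by have := edge_not_Gge hl gh; rewrite /Gge connect1 // re.
    - by rewrite (edge_irr hr) in ab.
  have : complete r l [set g; h] \in saturated_pairs r.
    by rewrite inE; apply: saturated_complete.
  rewrite -eqS => /imsetP [p]; rewrite inE => /independent_saturated.
  move=> /forall_inP indp [pE _].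
  have gp : g \in p.1 by rewrite -pE !inE eqxx.
  have hp : h \in p.1 by rewrite -pE !inE eqxx orbT.
  by move/forall_inP: (indp g gp) => /(_ h hp); rewrite gh.
have er : r =2 e.
  by move=> g h; apply/idP/idP => [/re //|]; apply/implyP/(forallP (H g)).
rewrite (card_in_imset finj); apply: eq_card => p; rewrite !inE.
rewrite /saturated; congr (_ && _); apply: eq_forallb => k.
by congr (_ == _ && _); apply: eq_forallb => u; rewrite /converse er.
Qed.

End Counting.

(** * Lattices exclude forbidden partitions *)

Section LatticeForbidden.
Variables (T : finType) (e : rel T) (l l' : seq T).
Hypotheses (hl : linear_extension e l) (hl' : linear_extension (converse e) l').
Implicit Types (Y : {set T}) (p : {set T} * {set T}).

(** Each closed set of the relation r introduced in the proof is the set of g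
    with j g <= w, where w is the meet of some of the m h; this bounds their
    number by the number of saturated pairs of [e]. *)
Lemma lattice_card : has_joins e -> has_meets e ->
  #|closed e| = #|saturated_pairs e|.
Proof.
move=> joins meets.
pose j g := complete e l [set g].
pose m h := swap (complete (converse e) l' [set h]).
have ind1 (r : rel T) g : (forall k, r k k = false) -> independent r [set g].
  move=> irr; apply/forall_inP => a /set1P ->; apply/forall_inP => b /set1P ->.
  by rewrite irr.
have sj g : saturated e (j g).
  by apply: saturated_complete => //; apply: ind1 => k; apply: (edge_irr hl).
have sm h : saturated e (m h).
  rewrite -saturated_converse swapK; apply: saturated_complete => //.
  by apply: ind1 => k; apply: (edge_irr hl').
pose r : rel T := fun g h => (g != h) && ~~ steps e (j g) (m h).
have re : subrel r e.
  move=> g h /andP [gh]; apply: contraNT => egh.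
  apply: (steps_generator hl hl') => //; apply/perpP => k /set1P ->.
  by rewrite gh egh.
have cr : subrel (converse r) (converse e) by move=> g h; apply: re.
have hr := linear_extension_sub re hl; have hr' := linear_extension_sub cr hl'.
have perprE g Y : (g \in perp r Y) = [forall h in Y, steps e (j g) (m h)].
  apply/perpP/forall_inP => H h /H.
    by case/andP => gh; rewrite negb_and gh negbK.
  move=> jm; rewrite negb_and !negbK jm orbT andbT.
  apply: contraTneq jm => ->; exact: (generator_not_below hl hl').
(* The value for the empty list is a greatest element for the j g. *)
have inf (s : seq T) : exists2 w, saturated e w &
    forall g, steps e (j g) w = all (fun h => steps e (j g) (m h)) s.
  elim: s => [|h s [w sw wE]] /=.
    pose w := swap (complete (converse e) l' set0).
    have sw : saturated e w.
      rewrite -saturated_converse swapK; apply: saturated_complete => //.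
      by apply/forall_inP => g; rewrite inE.
    exists w => // g; apply: (steps_generator hl hl') => //.
    by apply/perpP => h; rewrite inE.
  have [v [sv vm vw greatest]] := meets _ _ (sm h) sw.
  exists v => // g; rewrite -wE; apply/idP/andP => [jv|[]]; last first.
    exact: greatest.
  by split; apply: connect_trans jv _.
have le1 : #|closed r| <= #|saturated_pairs e|.
  apply: leq_trans (leq_imset_card (fun w => [set g | steps e (j g) w]) _).
  apply/subset_leq_card/subsetP => X /imsetP [Y _ ->].
  have [w sw wE] := inf (enum Y).
  apply/imsetP; exists w; rewrite ?inE //; apply/setP => g.
  rewrite perprE inE wE; apply/forall_inP/allP => H h hY; apply: H.
    by rewrite -mem_enum.
  by rewrite mem_enum.
have [le2 eq2] := saturated_card_sub hl re.
have le3 := leq_saturated_closed hr hr'.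
have eqer : #|saturated_pairs e| == #|saturated_pairs r|.
  by rewrite eqn_leq le2 (leq_trans le3 le1).
move: eqer; rewrite eq2 => /forallP er.
have rE : r =2 e.
  by move=> g h; apply/idP/idP => [/re //|]; apply/implyP/(forallP (er g)).
have closedE : closed r = closed e.
  apply: eq_imset => Y; apply/setP => g; rewrite !inE; congr (_ && _).
  by apply: eq_forallb => u; rewrite rE.
apply/eqP; rewrite eqn_leq (leq_saturated_closed hl hl') andbT -closedE.
exact: le1.
Qed.

(** The maps to perp U and to perp (perp' D) are injective, hence onto the
    closed sets by counting. The second is contained in the first pointwise,
    and both have the same total cardinality, so they are equal. *)
Lemma card_perp_perp : #|closed e| = #|saturated_pairs e| ->
  (forall Y, exists2 p, saturated e p & perp e Y = perp e p.2) /\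
  (forall p, saturated e p -> perp e (perp (converse e) p.1) = perp e p.2).
Proof.
move=> cardE.
pose hi p := perp e p.2; pose lo p := perp e (perp (converse e) p.1).
have hi_inj : {in saturated_pairs e &, injective hi}.
  by move=> p q; rewrite !inE => sp sq; apply: (perp_inj hl hl').
have lo_inj : {in saturated_pairs e &, injective lo}.
  move=> p q; rewrite !inE => sp sq eq_lo; apply/(can_inj (@swapK T)).
  rewrite -!(saturated_converse e) in sp sq.
  apply: (perp_inj hl' hl) => //=.
  by rewrite -[LHS](perpK (converse e)) -[RHS](perpK (converse e)); congr perp.
have im f : {in saturated_pairs e &, injective f} ->
    (forall p, f p \in closed e) -> f @: saturated_pairs e = closed e.
  move=> finj fc; apply/eqP.
  rewrite eqEcard (card_in_imset finj) cardE leqnn andbT.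
  by apply/subsetP => X /imsetP [p _ ->].
have hi_im : hi @: saturated_pairs e = closed e.
  by apply: im => // p; apply: imset_f.
have lo_im : lo @: saturated_pairs e = closed e.
  by apply: im => // p; apply: imset_f.
split=> [Y|].
  have : perp e Y \in closed e by apply: imset_f.
  by rewrite -hi_im => /imsetP [p]; rewrite inE => sp ->; exists p.
have sum_eq : \sum_(p in saturated_pairs e) #|lo p| =
              \sum_(p in saturated_pairs e) #|hi p|.
  have reindex f : {in saturated_pairs e &, injective f} ->
      f @: saturated_pairs e = closed e ->
      \sum_(p in saturated_pairs e) #|f p| = \sum_(X in closed e) #|X|.
    by move=> finj <-; rewrite big_imset.
  by rewrite !reindex.
have lohi p : p \in saturated_pairs e -> lo p \subset hi p.
  by rewrite inE => sp; apply/perpS/saturated_sub2.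
have := leqif_sum (fun p pS => subset_leqif_cards (lohi p pS)).
case=> _; rewrite sum_eq eqxx => /esym/forall_inP H p sp.
by apply/eqP/H; rewrite inE.
Qed.

(** Let p have closed set X4 and q have closed set X3 :|: X4. As perp' X4 does
    not meet X3 :|: X4, the pair made of the first component of p and the
    second one of q is saturated. It shares a component with each of p and q,
    so p = q, although X4 <> X3 :|: X4. *)
Lemma lattice_no_forbidden : has_joins e -> has_meets e ->
  ~ (exists X1 X2 X3 X4 Z : {set T}, forbidden_partition e X1 X2 X3 X4 Z).
Proof.
move=> joins meets [X1 [X2 [X3 [X4 [Z fp]]]]].
have [E4 E34 [x0 x03 x04] no_overlap] := forbidden_closed fp.
have [surj lohi] := card_perp_perp (lattice_card joins meets).
have [p sp] := surj (X1 :|: X2); rewrite E4 => pE.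
have [q sq] := surj X1; rewrite E34 => qE.
have pY : perp (converse e) p.1 = perp (converse e) X4.
  by rewrite pE -lohi // (perpK (converse e)).
have Dsub : p.1 \subset perp e q.2.
  by rewrite -qE (subset_trans (saturated_sub1 sp)) // -pE subsetUr.
have Usub : q.2 \subset perp (converse e) p.1 by rewrite -perp_galois.
have s : saturated e (p.1, q.2).
  apply/saturatedP; split=> /= [k /(subsetP Dsub)|k].
    by rewrite inE => /andP [].
  apply/setUP/andP => [[kD|kU]|[ki ko]].
  - move: (subsetP Dsub k kD); rewrite inE => /andP [_ ko]; split=> //.
    by move: kD; rewrite (saturated_mem1 _ sp) => /andP [].
  - move: (subsetP Usub k kU); rewrite inE => /andP [_ ki]; split=> //.
    by move: kU; rewrite (saturated_mem2 _ sq) => /andP [].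
  case: (boolP (k \in p.1)) => kD; first by left.
  case: (boolP (k \in q.2)) => kU; first by right.
  have /no_overlap : k \in perp (converse e) X4 by rewrite -pY inE kD.
  by rewrite qE inE kU ko.
have pq : p = q.
  rewrite -(saturated_inj1 hl s sp) //=.
  exact: (saturated_inj2 hl' s sq).
by move: x04; rewrite pE pq -qE inE x03.
Qed.

End LatticeForbidden.

(** * The characterization *)

Theorem theorem4p11 (T : finType) (e : rel T) (l l' : seq T)
    (he : acyclic e)
    (hl : linear_extension e l)
    (hl' : reverse_linear_extension e l') :
  is_lattice (top_le e l l') <->
  ~ (exists X1 X2 X3 X4 Z : {set T}, forbidden_partition e X1 X2 X3 X4 Z).
Proof.
have hc : linear_extension (converse e) l'.
  by case: hl' => pl' H; split=> // g h; apply: H.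
split=> [[_ _ _ meets joins]|nf]; last first.
  exact: (overlapping_lattice hl hc (no_forbidden_overlapping nf)).
have toTop p : saturated e p -> exists x : top e, val x = p.
  by rewrite -(is_top_saturated hl) => tp; exists (Sub p tp).
have satTop (x : top e) : saturated e (val x).
  by rewrite -(is_top_saturated hl) (valP x).
apply: (lattice_no_forbidden hl hc) => p q /toTop [x <-] /toTop [y <-].
  have [w [xw yw least]] := joins x y; exists (val w).
  rewrite -!(top_le_steps hl hc); split=> // z /toTop [t <-].
  rewrite -!(top_le_steps hl hc); exact: least.
have [w [wx wy greatest]] := meets x y; exists (val w).
rewrite -!(top_le_steps hl hc); split=> // z /toTop [t <-].
rewrite -!(top_le_steps hl hc); exact: greatest.
Qed.
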